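(* Let $d\ge1$. For $1\le i\le d$ let $(X_i,\rho_i)$ be a compact metric space equipped with an Ahlfors $s_i$-regular Borel probability measure $\mu_i$, where $0<s_i<\infty$. Equip $\prod_{i=1}^dX_i$ with the metric $\rho(x,y)=\max_{1\le i\le d}\rho_i(x_i,y_i)$ and the product measure $\mu$, i.e. $\mu(\prod_{i=1}^dA_i)=\prod_{i=1}^d\mu_i(A_i)$ for Borel sets $A_i\subset X_i$. For $1\le i\le d$ let $\{B_i(x_{n,i},r_n)\}_{n\ge1}$ be a sequence of balls in $X_i$, with $r_n>0$ and $r_n\to0$ as $n\to\infty$. Let $a_1,\dots,a_d$ be real numbers with $1\le a_1\le\dots\le a_d$. Assume that \[\mu\Big(\limsup_{n\to\infty}\prod_{i=1}^dB_i(x_{n,i},r_n)\Big)=1.\] Then \[\limsup_{n\to\infty}\prod_{i=1}^dB_i(x_{n,i},r_n^{a_i})\in\mathcal{G}^s\Big(\prod_{i=1}^dX_i\Big),\] where \[s=\min_{1\le i\le d}\Big\{\frac{\sum_{j=1}^ds_j+a_i\sum_{j=1}^is_j-\sum_{j=1}^ia_js_j}{a_i}\Big\}.\]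
   Context: $B_i(x,r)$ is the open ball in $X_i$ with centre $x$ and radius $r$. A Borel measure $\nu$ on a metric space $Y$ is Ahlfors $\sigma$-regular ($0<\sigma<\infty$) if there is $1\le C<\infty$ with $C^{-1}r^\sigma\le\nu(B(x,r))\le Cr^\sigma$ for all $x\in Y$ and $0<r\le\operatorname{diam}Y$, $B(x,r)$ being the open ball. For sets $F_n$, $\limsup_{n\to\infty}F_n=\bigcap_{m\ge1}\bigcup_{n\ge m}F_n$. Write $X=\prod_{i=1}^dX_i$ and $\tau=\dim_{\rm H}X=\sum_{i=1}^ds_i$. In $(X,\rho)$ let $B(x,r)$ and $\overline{B}(x,r)$ be the balls $\{\rho(x,\cdot)<r\}$ and $\{\rho(x,\cdot)\le r\}$. Generalized dyadic cubes of $X$: fix $0<b<1/3$ and put $c_1=\frac12-\frac{b}{1-b}$, $c_1'=\frac1{1-b}$. Fix a family of Borel sets $\{Q_{n,i}: n\in\mathbb{Z}, i\in\mathbb{N}_n\subset\mathbb{N}\}$ (which exists by a known theorem) such that: (1) $X=\bigcup_{i\in\mathbb{N}_n}Q_{n,i}$ for every $n$, the sets $Q_{n,i}$ with the same $n$ and distinct $i$ being disjoint; (2) for $n\ge m$, either $Q_{n,i}\cap Q_{m,j}=\varnothing$ or $Q_{n,i}\subset Q_{m,j}$; (3) for each $n,i$ there is $z_{n,i}\in X$ with $B(z_{n,i},c_1b^n)\subset Q_{n,i}\subset\overline{B}(z_{n,i},c_1'b^n)$; (4) there is $z_0\in X$ such that for every $n$ there is $i$ with $B(z_0,c_1b^n)\subset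 Q_{n,i}$; (5) $\{z_{n,i}\}_{i\in\mathbb{N}_n}\subset\{z_{n+1,i}\}_{i\in\mathbb{N}_{n+1}}$ for all $n$. Put $\mathcal{Q}_0=\{X\}$, $\mathcal{Q}_n=\{Q_{n,i}:i\in\mathbb{N}_n\}$ for $n\ge1$, and $\mathcal{Q}=\bigcup_{n\ge0}\mathcal{Q}_n$. Large intersection classes: for $0<t\le\tau$ and $F\subset X$ let $\mathscr{M}^t_\infty(F)=\inf\{\sum_{i}\mu(Q_i)^{t/\tau}: F\subset\bigcup_{i}Q_i,\ Q_i\in\mathcal{Q}\}$ (countable covers). $\mathcal{G}^t(X)$ is the class of all $G_\delta$ sets $F\subset X$ such that for every $0<t'<t$ and every $Q\in\mathcal{Q}$, $\mathscr{M}^{t'}_\infty(F\cap Q)=\mathscr{M}^{t'}_\infty(Q)$. *)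

(* Defs.v *)
From HB Require Import structures.
From mathcomp Require Import all_boot all_order all_algebra.
From mathcomp Require Import all_classical all_reals all_analysis.
From mathcomp Require Import borel_hierarchy.

Set Implicit Arguments.
Unset Strict Implicit.
Unset Printing Implicit Defensive.

Import Order.TTheory GRing.Theory Num.Theory.
Import numFieldNormedType.Exports.

Local Open Scope classical_set_scope.
Local Open Scope ring_scope.

(* Measurable types are pointed in the library, so the metric spaces have to be
   too; a space carrying a probability measure is nonempty anyway. *)
#[short(type="pmetricType")]
HB.structure Definition PointedMetric (R : numDomainType) :=
  {T of Pointed T & Metric R T}.

Definition borel (T : ptopologicalType) : Type := g_sigma_algebraType (@open T).

HB.instance Definition _ (T : ptopologicalType) :=
  Measurable.copy (borel T) (g_sigma_algebraType (@open T)).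

(* An alias of the dependent product, distinct from the library's
   [prod_topology], whose balls are not those of the maximum metric. *)
Definition max_prod (R : realType) (d : nat) (X : 'I_d -> pmetricType R) :
  Type := forall i, X i.

Section max_prod_metric.
Variables (R : realType) (d : nat) (X : 'I_d -> pmetricType R).
Local Notation XX := (max_prod X).
Implicit Types x y z : XX.

Definition max_dist x y : R :=
  \big[Num.max/0]_(i < d) mdist (x i : X i) (y i : X i).

Let max_dist_le x y (e : R) :
  0 <= e -> (forall i, mdist (x i) (y i) <= e) -> max_dist x y <= e.
Proof. by move=> e0 h; apply: bigmax_le. Qed.

Let le_max_dist x y i : mdist (x i) (y i) <= max_dist x y.
Proof. exact: (le_bigmax _ (fun i => mdist (x i) (y i)) i). Qed.

Let max_dist_ge0 x y : 0 <= max_dist x y.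
Proof. exact: bigmax_ge_id. Qed.

Let max_distxx x : max_dist x x = 0.
Proof.
apply/eqP; rewrite eq_le max_dist_ge0 andbT.
by apply: max_dist_le => // i; rewrite mdistxx.
Qed.

Let max_dist_positivity x y : max_dist x y = 0 -> x = y.
Proof.
move=> xy0; apply: functional_extensionality_dep => i.
apply: mdist_positivity; apply/eqP; rewrite eq_le mdist_ge0 andbT.
by rewrite -xy0 le_max_dist.
Qed.

Let max_dist_sym x y : max_dist x y = max_dist y x.
Proof. by apply: eq_bigr => i _; rewrite metric_sym. Qed.

Let max_dist_triangle y x z : max_dist x z <= max_dist x y + max_dist y z.
Proof.
apply: max_dist_le => [|i]; first by rewrite addr_ge0.
by rewrite (le_trans (metric_triangle _ (y i) _))// lerD.
Qed.

HB.instance Definition _ := gen_eqMixin XX.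
HB.instance Definition _ := gen_choiceMixin XX.
HB.instance Definition _ := isPointed.Build XX (fun i => point : X i).
HB.instance Definition _ := @isMetric.Build R XX max_dist
  max_distxx max_dist_positivity max_dist_sym max_dist_triangle.

End max_prod_metric.

Definition prod_set (R : realType) (d : nat) (X : 'I_d -> pmetricType R)
    (A : forall i, set (X i)) : set (max_prod X) :=
  [set x | forall i, A i (x i)].

Definition diam (R : realType) (Y : metricType R) : \bar R :=
  ereal_sup [set (mdist xy.1 xy.2)%:E | xy in [set: Y * Y]].

Definition ahlfors_regular (R : realType) (Y : pmetricType R)
    (nu : set Y -> \bar R) (sigma : R) : Prop :=
  exists2 C : R, 1 <= C & forall (x : Y) (r : R),
    0 < r -> (r%:E <= diam Y)%E ->
    ((C^-1 * r `^ sigma)%:E <= nu (ball x r) <= (C * r `^ sigma)%:E)%E.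

(* The closed ball of the metric; the library's [closed_ball] is instead the
   closure of the open ball, which can be smaller. *)
Definition metric_closed_ball (R : realType) (Y : metricType R)
    (x : Y) (r : R) : set Y := [set y | mdist x y <= r].

Definition generalized_dyadic_cubes (R : realType) (Y : pmetricType R) (b : R)
    (N : int -> set nat) (Q : int -> nat -> set Y) : Prop :=
  let c1 := 2^-1 - b / (1 - b) in
  let c1' := (1 - b)^-1 in
  exists z : int -> nat -> Y,
  [/\ forall n i, N n i -> measurable (Q n i : set (borel Y)),
      forall n, \bigcup_(i in N n) Q n i = setT /\ trivIset (N n) (Q n),
      forall m n i j, m <= n -> N n i -> N m j ->
        Q n i `&` Q m j = set0 \/ Q n i `<=` Q m j,
      forall n i, N n i -> ball (z n i) (c1 * b ^ n) `<=` Q n i /\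
        Q n i `<=` metric_closed_ball (z n i) (c1' * b ^ n) &
      (exists z0 : Y, forall n,
         exists2 i, N n i & ball z0 (c1 * b ^ n) `<=` Q n i) /\
      (forall n, z n @` N n `<=` z (n + 1) @` N (n + 1))].

(* The cubes of nonnegative generation, generation 0 being {Y}. *)
Definition dyadic_family (Y : Type) (N : int -> set nat)
    (Q : int -> nat -> set Y) : set (set Y) :=
  [set setT] `|` [set A | exists n i, [/\ (1 <= n)%R, N n i & A = Q n i]].

(* Countable covers are indexed by arbitrary subsets of nat, hence may be
   finite or empty. *)
Definition dyadic_content (R : realType) (Y : Type) (mu : set Y -> \bar R)
    (tau : R) (QQ : set (set Y)) (t : R) (F : set Y) : \bar R :=
  ereal_inf [set v | exists (I : set nat) (C : nat -> set Y),
    [/\ forall k, I k -> QQ (C k), F `<=` \bigcup_(k in I) C k &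
        v = \esum_(k in I) (mu (C k) `^ (t / tau))%E]].

(* [t] is meant to range over ]0, tau]. *)
Definition large_intersection_class (R : realType) (Y : pmetricType R)
    (mu : set Y -> \bar R) (tau : R) (QQ : set (set Y)) (t : R) :
    set (set Y) :=
  [set F | Gdelta F /\ forall t' A, 0 < t' < t -> QQ A ->
    dyadic_content mu tau QQ t' (F `&` A) = dyadic_content mu tau QQ t' A].

Definition mtp_exponent (R : realType) (d : nat) (s a : 'I_d -> R) (i : 'I_d) :
    R :=
  (\sum_(j < d) s j + a i * (\sum_(j < d | (j <= i)%N) s j)
     - \sum_(j < d | (j <= i)%N) a j * s j) / a i.

(* The minimum over the nonempty index set: the first term seeds the fold. *)
Definition min_mtp_exponent (R : realType) (d : nat) (d_gt0 : (0 < d)%N)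
    (s a : 'I_d -> R) : R :=
  \big[Num.min/mtp_exponent s a (Ordinal d_gt0)]_(i < d) mtp_exponent s a i.

(* Main.v *)
Require Import Defs.
From HB Require Import structures.
From mathcomp Require Import all_boot all_order all_algebra.
From mathcomp Require Import all_classical all_reals all_analysis.
From mathcomp Require Import measurable_realfun ring lra.

(** Write [E_n] for the rectangles, [W_n] for the balls of radius [r_n] that
    contain them, and let [0 < t < s].  As [t / tau <= 1], covering a cube [A]
    by itself is optimal, so that the content of [A] is [mu(A)^(t/tau)]; what
    has to be shown is that cubes [C_k] with
    [sum_k mu(C_k)^(t/tau) < mu(A)^(t/tau)] never cover the part of
    [limsup E_n] in [A].  Such a family even has [sum_k mu(C_k) < mu(A)], and a
    point of [limsup E_n] in [A] but in no [C_k] is constructed.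

    Let [C_k] lie in the ball of centre [z_k] and radius [R_k], so that
    [sum_k R_k^t] is finite, and let [beta = tau - (s - t)/2].  Call [y] sparse
    when, for all small [r], the [C_k] that meet [B(y,r)] have [R_k < r] and
    [sum R_k^t <= M r^beta] over these [k].  Because [beta < tau], the potential
    [sum_k R_k^t d(y,z_k)^(-beta)] is integrable, so at almost every [y] the
    total weight of the centres within distance [r] is [O(r^beta)]
    ([ae_local_weight]).  Such a [y] is sparse as soon as it avoids
    [B(z_k, 3 R_k)] for every [C_k] that meets a neighbourhood of [y].  Hence an
    open set whose measure is not exhausted by these balls contains a sparse
    point, which may be taken in the full-measure set [limsup W_n]
    ([tame_escape]).

    If [y] is sparse and lies in [W_n] with [r_n] small, then
    [mu(E_n & B(z_k, 3 R_k)) <= c R_k^s r_n^(-tau) mu(E_n)], and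
    [R_k^s <= (2 r_n)^(s-t) R_k^t]; summing over the [C_k] that meet [E_n] gives
    at most [c' r_n^(s-t-tau+beta) mu(E_n) = c' r_n^((s-t)/2) mu(E_n)], less
    than [mu(E_n)].  So [E_n] contains a sparse point of [limsup W_n] again
    ([sparse_step]), and the construction can be iterated inside [E_n].  The
    nested balls obtained have a common point by compactness; it lies in
    infinitely many [E_n], and in no [C_k], since a [C_k] containing it would
    meet all these balls and hence have [R_k = 0] ([sparse_limsup]).

    To start, choose a generic [y] in [A] outside all [C_k] and a small cube
    [B] around [y].  By nestedness a [C_k] that meets [B] without containing
    [y] is of a later generation than [B]: the [C_k] near [B] are therefore
    small, of total weight [O(r^beta)] when [B] has size [r], and [tame_escape]
    applies inside [B] ([limsup_not_covered]).

    That [s] is the right exponent for rectangles is elementary: for every set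
    [J] of coordinates, [E_n] and a ball of radius [rho] share at most a
    fraction [c prod_(i in J) (rho / r_n^(a_i))^(s_i)] of [E_n]
    ([rectangle_ball_le]), and for a suitable [J] this is at most
    [c rho^s r_n^(-tau)] ([exists_rectangle_section]). *)

Set Implicit Arguments.
Unset Strict Implicit.
Unset Printing Implicit Defensive.

Import Order.TTheory GRing.Theory Num.Theory.
Import numFieldNormedType.Exports.

Local Open Scope classical_set_scope.
Local Open Scope ring_scope.

(** * Series, measures and powers *)

Lemma nneseries_le_scale (R : realType) (u v : nat -> \bar R) (A B : set nat)
    (c : R) : 0 <= c -> A `<=` B ->
  (forall k, A k -> 0 <= u k)%E -> (forall k, B k -> 0 <= v k)%E ->
  (forall k, A k -> u k <= c%:E * v k)%E ->
  (\sum_(k <oo | k \in A) u k <= c%:E * \sum_(k <oo | k \in B) v k)%E.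
Proof.
move=> c0 AB u0 v0 uv.
rewrite -nneseriesZl; last by move=> k /set_mem; exact: v0.
apply: (@le_trans _ _ (\sum_(k <oo | k \in A) (c%:E * v k))%E).
  apply: lee_nneseries => [k _ /set_mem|k /set_mem]; [exact: u0|exact: uv].
apply: subset_lee_nneseries => k /set_mem.
  by move=> /v0 ?; rewrite mule_ge0// lee_fin.
by move=> /AB/mem_set.
Qed.

Lemma open_mball (R : realType) (Y : metricType R) (x : Y) (r : R) :
  open (ball x r).
Proof.
rewrite openE => y; rewrite /interior ballEmdist/= => xyr.
have e0 : 0 < r - mdist x y by rewrite subr_gt0.
apply: filterS (nbhsx_ballx y _ e0) => z; rewrite !ballEmdist/= => yz.
by rewrite (le_lt_trans (metric_triangle _ y _))// addrC -ltrBrDr.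
Qed.

Lemma open_borel (T : ptopologicalType) (A : set T) :
  open A -> measurable (A : set (borel T)).
Proof. by move=> oA; exact: (@sub_sigma_algebra T setT (@open T)). Qed.

Lemma ball_borel (R : realType) (Y : pmetricType R) (x : Y) (r : R) :
  measurable (ball x r : set (borel Y)).
Proof. by apply: open_borel; exact: open_mball. Qed.

Lemma powR_invr (R : realType) (x t : R) : 0 <= x -> x^-1 `^ t = (x `^ t)^-1.
Proof. by move=> x0; rewrite -powR_inv1// -powRrM mulN1r powRN. Qed.

Lemma gt0_powRD (R : realType) (x p q : R) :
  0 < x -> x `^ (p + q) = x `^ p * x `^ q.
Proof. by move=> x0; rewrite powRD// (gt_eqF x0) implybT. Qed.

Lemma powR_exprn (R : realType) (x t : R) n :
  0 <= x -> (x ^+ n) `^ t = (x `^ t) ^+ n.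
Proof. by move=> x0; rewrite -!powR_mulrn ?powR_ge0// powRAC. Qed.

Lemma ae_setI_nonempty d (T : measurableType d) (R : realType)
    (mu : {measure set T -> \bar R}) (A : set T) (P Q : T -> Prop) :
  measurable A -> (0 < mu A)%E ->
  {ae mu, forall y, P y} -> {ae mu, forall y, Q y} ->
  exists2 y, A y & P y /\ Q y.
Proof.
move=> mA muA aeP aeQ; apply: contrapT => noy.
have : mu.-negligible A.
  apply: negligibleS (negligibleU aeP aeQ) => y Ay.
  apply: contrapT => /not_orP[/contrapT Py /contrapT Qy].
  by apply: noy; exists y.
by move=> /(measure_negligible mA) muA0; rewrite muA0 ltxx in muA.
Qed.

Lemma powR_small (R : realType) (c g e : R) : 0 < g -> 0 < e ->
  exists2 h : R, 0 < h & forall u, 0 < u < h -> c * u `^ g < e.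
Proof.
move=> g0 e0; have c0 : 0 < `|c| + 1 by rewrite ltr_wpDl.
have ec : 0 < e / (`|c| + 1) by rewrite divr_gt0.
exists ((e / (`|c| + 1)) `^ g^-1); first by rewrite powR_gt0.
move=> u /andP[u0 uh].
have uge : u `^ g < e / (`|c| + 1).
  have -> : e / (`|c| + 1) = ((e / (`|c| + 1)) `^ g^-1) `^ g.
    by rewrite -powRrM mulVf ?gt_eqF// powRr1// ltW.
  by apply: gt0_ltr_powR => //; rewrite nnegrE ?powR_ge0 ?ltW//.
apply: (@le_lt_trans _ _ ((`|c| + 1) * u `^ g)).
  by rewrite ler_wpM2r ?powR_ge0// (le_trans (ler_norm _))// lerDl.
by rewrite mulrC -ltr_pdivlMr.
Qed.

Lemma measure_le_nneseries d (T : measurableType d) (R : realType)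
    (mu : {measure set T -> \bar R}) (I : set nat) (F : nat -> set T) :
  (forall k, I k -> measurable (F k)) ->
  (mu (\bigcup_(k in I) F k) <= \sum_(k <oo | k \in I) mu (F k))%E.
Proof.
move=> mF; rewrite eseries_mkcond [X in mu X]bigcup_mkcond.
have mF' k : measurable (if k \in I then F k else set0).
  by case: ifPn => // /set_mem; exact: mF.
apply: (@le_trans _ _ (\sum_(k <oo) mu (if k \in I then F k else set0))%E).
  by apply: measure_sigma_subadditive => //; exact: bigcup_measurable.
by apply: lee_nneseries => // k _; case: ifP => // _; rewrite measure0.
Qed.

Lemma esum_nneseries (R : realType) (I : set nat) (a : nat -> \bar R) :
  (forall k, I k -> 0 <= a k)%E ->
  \esum_(k in I) a k = (\sum_(k <oo | k \in I) a k)%E.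
Proof.
move=> a0; rewrite nneseries_esum; last by move=> k /set_mem; exact: a0.
by congr esum; apply/seteqP; split=> k /=; [move/mem_set|move/set_mem].
Qed.

(** Subadditivity of [u |-> u^theta]: each [mu(F_k)] is below [a = mu(A)], so
    [mu(F_k) <= a^(1 - theta) * mu(F_k)^theta], and the right-hand sides add up
    to less than [a]. *)
Lemma measure_bigcup_lt d (T : measurableType d) (R : realType)
    (mu : probability T R) (theta : R) (I : set nat) (F : nat -> set T)
    (A : set T) :
  0 < theta <= 1 -> (forall k, I k -> measurable (F k)) -> measurable A ->
  (\sum_(k <oo | k \in I) mu (F k) `^ theta < mu A `^ theta)%E ->
  (forall k, I k -> mu (F k) < mu A)%E /\ (mu (\bigcup_(k in I) F k) < mu A)%E.
Proof.
move=> /andP[theta0 theta1] mF mA small.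
pose a := fine (mu A); have muA : mu A = a%:E by rewrite fineK// fin_num_measure.
have a0 : 0 <= a by rewrite fine_ge0.
have muF k : I k -> mu (F k) = (fine (mu (F k)))%:E.
  by move=> Ik; rewrite fineK// fin_num_measure//; exact: mF.
have Fa k : I k -> fine (mu (F k)) < a.
  move=> Ik; have : (mu (F k) `^ theta < mu A `^ theta)%E.
    apply: le_lt_trans small; rewrite (@nneseriesD1 _ _ k) ?mem_set//; last first.
      by move=> i _; exact: poweR_ge0.
    by rewrite leeDl// nneseries_ge0// => i _ _; exact: poweR_ge0.
  rewrite muA muF// !poweR_EFin lte_fin => h.
  rewrite ltNge; apply/negP => ak; move: h; rewrite ltNge => /negP; apply.
  by rewrite ge0_ler_powR ?nnegrE ?(ltW theta0)// (le_trans a0).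
split=> [k Ik|]; first by rewrite muA muF// lte_fin Fa.
have a_gt0 : 0 < a.
  rewrite lt_neqAle a0 andbT; apply/eqP => a_eq0.
  move: small; rewrite muA -a_eq0 poweR0r ?gt_eqF// ltNge nneseries_ge0// => k _ _.
  exact: poweR_ge0.
apply: (le_lt_trans (measure_le_nneseries _ mF)).
apply: (@le_lt_trans _ _ ((a `^ (1 - theta))%:E *
    \sum_(k <oo | k \in I) mu (F k) `^ theta)%E).
  apply: nneseries_le_scale => // [|k _|k Ik]; rewrite ?powR_ge0 ?poweR_ge0//.
  have muFk := muF _ Ik; have := Fa _ Ik.
  have : 0 <= fine (mu (F k)) by rewrite fine_ge0.
  set f := fine _ in muFk *.
  rewrite le_eqVlt => f0 fa; rewrite -[leLHS]/(mu (F k)) !muFk.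
  rewrite poweR_EFin -EFinM lee_fin; case/predU1P : f0 => [<-|f0].
    by rewrite mulr_ge0 ?powR_ge0.
  rewrite -[leLHS]powRr1 ?(ltW f0)// -[X in f `^ X](subrK theta) gt0_powRD//.
  rewrite ler_wpM2r ?powR_ge0//.
  by rewrite ge0_ler_powR ?nnegrE ?subr_ge0// ltW.
apply: (@lt_le_trans _ _ ((a `^ (1 - theta))%:E * mu A `^ theta)%E).
  by rewrite lte_pmul2l// lte_fin powR_gt0.
by rewrite muA poweR_EFin -EFinM -gt0_powRD// subrK powRr1.
Qed.

(** * Small balls charged by a summable family *)

Section potential.
Variables (R : realType) (Y : pmetricType R) (mu : probability (borel Y) R).
Variables (tau beta K : R).
Hypotheses (beta_ge0 : 0 <= beta) (beta_lt : beta < tau) (K_ge0 : 0 <= K).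
Hypothesis mu_ball : forall (z : Y) (r : R), 0 < r ->
  (mu (ball z r) <= (K * r `^ tau)%:E)%E.

(** The series over [j] of this kernel is comparable to the Riesz kernel
    [d(z,y)^(-beta)] when [d(z,y) < 1] and [beta > 0]; summing indicators of
    balls makes its integral a geometric series. *)
Definition dyadic_kernel (z y : Y) (j : nat) : \bar R :=
  ((2 ^+ j) `^ beta * \1_(ball z (2 ^- j)) y)%:E.

Lemma dyadic_kernel_ge0 z y j : (0 <= dyadic_kernel z y j)%E.
Proof. by rewrite lee_fin mulr_ge0// powR_ge0. Qed.

Lemma measurable_dyadic_kernel z j :
  measurable_fun [set: borel Y] (dyadic_kernel z ^~ j : borel Y -> \bar R).
Proof.
apply/measurable_EFinP; apply: measurable_funM => //.
by apply: measurable_indic; exact: ball_borel.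
Qed.

Let q := 2 `^ (beta - tau).
Let q01 : 0 < q < 1.
Proof.
rewrite powR_gt0//= /q /powR pnatr_eq0/= -[ltRHS]expR0 ltr_expR.
by rewrite nmulr_rlt0 ?subr_lt0 ?ln_gt0 ?ltr1n.
Qed.

Lemma integral_dyadic_kernel z j :
  (\int[mu]_y dyadic_kernel z y j <= (K * q ^+ j)%:E)%E.
Proof.
rewrite /dyadic_kernel; under eq_integral do rewrite EFinM.
rewrite ge0_integralZl//=; last first.
  by apply/measurable_EFinP; apply: measurable_indic; exact: ball_borel.
rewrite integral_indic//; last exact: ball_borel.
rewrite setIT.
apply: (@le_trans _ _ (((2 ^+ j) `^ beta)%:E * (K * (2 ^- j) `^ tau)%:E)%E).
  by rewrite lee_pmul2l//= ?mu_ball// ?lte_fin ?invr_gt0 ?powR_gt0 ?exprn_gt0.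
rewrite -EFinM lee_fin mulrCA ler_wpM2l//.
have a0 : 0 < 2 ^+ j :> R by rewrite exprn_gt0.
rewrite powR_invr ?(ltW a0)// -powRB ?(lt_eqF beta_lt)//.
by rewrite powR_exprn.
Qed.

Definition dyadic_potential (z y : Y) : \bar R :=
  \sum_(j <oo) dyadic_kernel z y j.

Lemma integral_dyadic_potential z :
  (\int[mu]_y dyadic_potential z y <= (K / (1 - q))%:E)%E.
Proof.
rewrite integral_nneseries//; last 2 first.
- by move=> j; exact: measurable_dyadic_kernel.
- by move=> j y _; exact: dyadic_kernel_ge0.
have /andP[q0 q1] := q01.
have cvgq : (\sum_(0 <= j < n) (K * q ^+ j)%:E)%E @[n --> \oo] -->
    (K / (1 - q))%:E.
  under eq_fun do rewrite sumEFin.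
  by apply: cvg_EFin; [exact: nearW|apply: cvg_geometric_series; rewrite gtr0_norm].
rewrite -(cvg_lim _ cvgq)//; apply: lee_nneseries => [j _ _|j _].
- by apply: integral_ge0 => y _; exact: dyadic_kernel_ge0.
- exact: integral_dyadic_kernel.
Qed.

(** The sum of the potentials of the centres [z_k] with weights [w_k] has finite
    integral, hence is finite almost everywhere; at scale [r] the [j]-th term
    with [2^(-j)] just above [r] bounds the weight of the centres within [r]. *)
Lemma ae_local_weight (z : nat -> Y) (w : nat -> R) :
  (forall k, 0 <= w k) -> (\sum_(k <oo) (w k)%:E < +oo)%E ->
  {ae mu, forall y, exists2 M : R, 0 <= M & forall r, 0 < r <= 1 ->
    (\sum_(k <oo | k \in [set k | (mdist (z k) y < r)%R]) (w k)%:E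
      <= (M * r `^ beta)%:E)%E}.
Proof.
move=> w0 wfin.
pose H (y : borel Y) := (\sum_(k <oo) ((w k)%:E * dyadic_potential (z k) y))%E.
have pot0 z0 y : (0 <= dyadic_potential z0 y)%E.
  by apply: nneseries_ge0 => j _ _; exact: dyadic_kernel_ge0.
have mpot z0 : measurable_fun setT (dyadic_potential z0 : borel Y -> \bar R).
  apply: ge0_emeasurable_sum => [j y _ _|j _]; first exact: dyadic_kernel_ge0.
  exact: measurable_dyadic_kernel.
have H0 y : (0 <= H y)%E.
  by apply: nneseries_ge0 => k _ _; rewrite mule_ge0// lee_fin.
have mterm k :
    measurable_fun setT (fun y : borel Y => (w k)%:E * dyadic_potential (z k) y)%E.
  exact: measurable_funeM.
have mH : measurable_fun setT H.
  by apply: ge0_emeasurable_sum => [k y _ _|k _//]; rewrite mule_ge0// lee_fin.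
have iH : (\int[mu]_y H y < +oo)%E.
  rewrite integral_nneseries//; last by move=> k y _; rewrite mule_ge0// lee_fin.
  have /andP[q0 q1] := q01.
  have KM : (0 <= K / (1 - q))%R by rewrite divr_ge0// subr_ge0 ltW.
  apply: (@le_lt_trans _ _ ((K / (1 - q))%:E * \sum_(k <oo) (w k)%:E)%E).
    rewrite -nneseriesZl//; last by move=> k _; rewrite lee_fin.
    apply: lee_nneseries => [k _ _|k _].
      by apply: integral_ge0 => y _; rewrite mule_ge0// lee_fin.
    rewrite ge0_integralZl//; last by rewrite lee_fin.
    rewrite muleC; apply: lee_wpmul2r; first by rewrite lee_fin.
    exact: integral_dyadic_potential.
  have wf : (\sum_(k <oo) (w k)%:E)%E \is a fin_num.
    by rewrite ge0_fin_numE// nneseries_ge0// => k _ _; rewrite lee_fin.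
  by rewrite -(fineK wf) -EFinM ltry.
have intH : mu.-integrable setT H.
  apply/integrableP; split => //.
  by under eq_integral do rewrite gee0_abs//.
have := integrable_ae measurableT intH.
apply: filterS => y /(_ I) Hy.
exists (2 `^ beta * fine (H y)); first by rewrite mulr_ge0 ?powR_ge0 ?fine_ge0.
move=> r /andP[r0 r1].
(* the dyadic scale just above r *)
have [j rj jr] : exists2 j : nat, r <= 2 ^- j & 2 ^- j < 2 * r.
  have ex : exists j : nat, 2 ^- j < 2 * r.
    have := @cvg_geometric R 1 2^-1.
    rewrite ger0_norm ?invr_ge0// invf_lt1// ltr1n => /(_ isT).
    move=> /cvgrPdist_lt/(_ (2 * r)); rewrite mulr_gt0// => /(_ isT)[n _ /(_ n)].
    rewrite /= leqnn sub0r normrN mul1r exprVn gtr0_norm ?invr_gt0 ?exprn_gt0//.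
    by move=> /(_ isT) ?; exists n.
  case: (ex_minnP ex) => -[|j] jr jmin.
    by exists 0%N => //; rewrite expr0 invr1.
  exists j.+1 => //; rewrite leNgt; apply/negP => rj.
  have : (j.+1 <= j)%N; last by rewrite ltnn.
  by apply: jmin; move: rj; rewrite exprS invfM; lra.
have Hfin := fineK Hy.
apply: (@le_trans _ _ (((2 ^- j) `^ beta)%:E * H y)%E); last first.
  rewrite -Hfin -EFinM lee_fin mulrAC -powRM ?(ltW r0)//.
  rewrite ler_wpM2r ?fine_ge0// ge0_ler_powR// ?nnegrE ?mulr_ge0 ?(ltW r0)//.
  exact: ltW.
rewrite /H -[X in (_ <= _ * X)%E](@eq_eseriesl _ (fun k => k \in [set: nat])); last first.
  by move=> k; rewrite in_setT.
apply: nneseries_le_scale => //.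
- by move=> k _; rewrite lee_fin.
- by move=> k _; rewrite mule_ge0// lee_fin.
move=> k /= kr.
rewrite muleCA -[leLHS]mule1; apply: lee_wpmul2l; first by rewrite lee_fin.
apply: (@le_trans _ _ (((2 ^- j) `^ beta)%:E * dyadic_kernel (z k) y j)%E).
  rewrite /dyadic_kernel indicE mem_set ?mulr1; last first.
    by rewrite ballEmdist/=; exact: lt_le_trans rj.
  by rewrite -EFinM -powRM ?invr_ge0 ?exprn_ge0// mulVf ?powR1 ?expf_neq0 ?pnatr_eq0.
apply: lee_wpmul2l; first by rewrite lee_fin powR_ge0.
rewrite /dyadic_potential (@nneseriesD1 _ _ j)//; last first.
  by move=> i _; exact: dyadic_kernel_ge0.
by rewrite leeDl// nneseries_ge0// => i _ _; exact: dyadic_kernel_ge0.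
Qed.

End potential.

(** * Sparse points *)

Section escape.
Variables (R : realType) (Y : pmetricType R) (mu : probability (borel Y) R).
Variables (t beta : R).
Variables (C : nat -> set Y) (z : nat -> Y) (rad : nat -> R).
Hypothesis C_sub : forall k, C k `<=` metric_closed_ball (z k) (rad k).

Definition meeting (A : set Y) : set nat := [set k | C k `&` A !=set0].

(** Finiteness of the potential at [y], in the form in which it is used. *)
Definition tame (y : Y) : Prop :=
  exists2 M : R, 0 <= M & forall r, 0 < r <= 1 ->
    (\sum_(k <oo | k \in [set k | (mdist (z k) y < r)%R]) (rad k `^ t)%:E
      <= (M * r `^ beta)%:E)%E.

Definition sparse (y : Y) : Prop :=
  exists M r0 : R, [/\ 0 <= M, 0 < r0 & forall r, 0 < r < r0 ->
    (forall k, meeting (ball y r) k -> rad k < r) /\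
    (\sum_(k <oo | k \in meeting (ball y r)) (rad k `^ t)%:E
      <= (M * r `^ beta)%:E)%E].

(** If [C_k] meets [B(y,r)] while [d(y,z_k) >= 3 R_k], then [2 R_k < r] and
    [d(y,z_k) < 2 r]: the sets that meet [B(y,r)] are small and have their
    centres near [y]. *)
Lemma tame_sparse (y : Y) (e : R) : 0 < e -> tame y ->
  (forall k, meeting (ball y e) k -> ~ ball (z k) (3 * rad k) y) -> sparse y.
Proof.
move=> e0 [M M0 tM] far.
exists (M * 2 `^ beta), (Num.min e 2^-1); split.
- by rewrite mulr_ge0// powR_ge0.
- by rewrite lt_min e0/=.
move=> r /andP[r0]; rewrite lt_min => /andP[re r2].
have near k : meeting (ball y r) k -> rad k < r /\ mdist (z k) y < 2 * r.
  move=> [p [Cp yp]].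
  have : meeting (ball y e) k.
    by exists p; split => //; exact: (le_ball (ltW re)).
  move=> /far; rewrite ballEmdist/= => /negP; rewrite -leNgt.
  have := C_sub Cp; rewrite /metric_closed_ball/=.
  move: yp; rewrite ballEmdist/=.
  have := metric_triangle (z k) p y; rewrite (metric_sym p y).
  by lra.
split=> [k /near[]//|].
apply: (@le_trans _ _ (M * (2 * r) `^ beta)%:E); last first.
  by rewrite powRM ?(ltW r0)// mulrA.
apply: (le_trans _ (tM _ _)); last by lra.
apply: subset_lee_nneseries => [k _|k /set_mem /near[_ h]].
  by rewrite lee_fin powR_ge0.
exact/mem_set.
Qed.

(** The balls [B(z_k, 3 R_k)] leave a subset of [O] of positive measure, and
    almost every point of it is tame. *)
Lemma tame_escape (P : Y -> Prop) (O : set Y) : open O ->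
  {ae mu, forall y, tame y} -> {ae mu, forall y, P y} ->
  (\sum_(k <oo | k \in meeting O) mu (O `&` ball (z k) (3 * rad k)) < mu O)%E ->
  exists y, [/\ O y, P y & sparse y].
Proof.
move=> oO aetame aeP small.
pose U := \bigcup_(k in meeting O) (O `&` ball (z k) (3 * rad k)).
have mO : measurable (O : set (borel Y)) by exact: open_borel.
have mUk k : measurable (O `&` ball (z k) (3 * rad k) : set (borel Y)).
  by apply: measurableI => //; exact: ball_borel.
have mU : measurable (U : set (borel Y)) by exact: bigcup_measurable.
have UO : (mu U < mu O)%E.
  by apply: le_lt_trans small; exact: measure_le_nneseries.
have pos : (0 < mu (O `\` U))%E.
  rewrite measureD//; last by rewrite ltey_eq fin_num_measure.
  rewrite sube_gt0; apply: le_lt_trans UO; apply: le_measure; rewrite ?inE//.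
  exact: measurableI.
have mOU : measurable (O `\` U : set (borel Y)) by exact: measurableD.
have [y [Oy nUy] [ty Py]] := ae_setI_nonempty mOU pos aetame aeP.
exists y; split=> //.
have /nbhs_ballP[e/= e0 eO] : nbhs y O by exact: open_nbhs_nbhs.
apply: (tame_sparse (e := e)) => // k [p [Cp yp]] zy.
apply: nUy; exists k; [exists p; split=> //; exact: eO|by split].
Qed.

End escape.

(** * Descending through the sets E_n *)

Section nested.
Variables (R : realType) (Y : pmetricType R) (mu : probability (borel Y) R).
Variables (tau s t K : R).
Hypotheses (ts : t < s) (K_ge0 : 0 <= K) (cptY : compact [set: Y]).
Variables (x : nat -> Y) (r : nat -> R) (E : nat -> set Y).
Hypothesis r_gt0 : forall n, 0 < r n.
Hypothesis r_cvg : r n @[n --> \oo] --> 0.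
Hypothesis E_open : forall n, open (E n).
Hypothesis E_sub : forall n, r n < 1 -> E n `<=` ball (x n) (r n).
Hypothesis muE_gt0 : forall n, r n < 1 -> (0 < mu (E n))%E.
Hypothesis muE_ball : forall n (z : Y) (rho : R), r n < 1 -> 0 < rho ->
  (mu (E n `&` ball z rho) <= (K * rho `^ s * r n `^ (- tau))%:E * mu (E n))%E.
Local Notation W := (fun n => ball (x n) (r n)).
Hypothesis ae_limsup : {ae mu, forall y, lim_sup_set W y}.

Local Notation beta := (tau - (s - t) / 2).
Variables (C : nat -> set Y) (z : nat -> Y) (rad : nat -> R).
Hypothesis C_sub : forall k, C k `<=` metric_closed_ball (z k) (rad k).
Hypothesis rad_gt0 : forall k, C k !=set0 -> 0 < rad k.
Hypothesis ae_tame : {ae mu, forall y, tame t beta z rad y}.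
Local Notation sparse := (sparse t beta C rad).

(** Sparseness at [y] bounds the sum over the [C_k] meeting [E_n] by
    [(2 r_n)^beta], and the bound on [mu (E_n & B(z, rho))] turns it into a
    fraction [c r_n^((s - t) / 2)] of [mu (E_n)]. *)
Lemma sparse_step (y : Y) (e : R) (m : nat) :
  lim_sup_set W y -> sparse y -> 0 < e ->
  exists n y', [/\ (m <= n)%N, E n `<=` ball y e, E n y', lim_sup_set W y'
    & sparse y'].
Proof.
move=> Wy [M [r0 [M0 r0_gt0 spy]]] e0.
have g0 : 0 < (s - t) / 2 by rewrite divr_gt0 ?subr_gt0.
pose c := K * 3 `^ s * M * 2 `^ (s - t + beta).
have [h h0 hP] := powR_small c g0 (@ltr01 R).
pose h1 := Num.min h (Num.min (r0 / 2) (Num.min (e / 2) 1)).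
have h1_gt0 : 0 < h1 by rewrite !lt_min h0 ltr01 !divr_gt0.
have [N _ rN] : \forall n \near \oo, r n < h1.
  by move/cvgrPdist_lt : r_cvg => /(_ _ h1_gt0); apply: filterS => n;
    rewrite sub0r normrN gtr0_norm.
have [n /= mNn Wny] := Wy (maxn m N) I.
move: mNn; rewrite geq_max => /andP[mn Nn].
have := rN _ Nn; rewrite /= !lt_min => /and4P[rh rr0 re r1].
have rn := r_gt0 n.
pose rho := 2 * r n.
have rho0 : 0 < rho by rewrite mulr_gt0.
have Esub : E n `<=` ball y rho.
  move=> p /(E_sub r1); move: Wny; rewrite !ballEmdist/= metric_sym.
  by have := metric_triangle y (x n) p; rewrite /rho; lra.
have [rad_lt sum_le] : (forall k, meeting C (ball y rho) k -> rad k < rho) /\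
    (\sum_(k <oo | k \in meeting C (ball y rho)) (rad k `^ t)%:E
      <= (M * rho `^ beta)%:E)%E.
  by apply: spy; rewrite /rho; lra.
have muEfin : mu (E n) \is a fin_num by rewrite fin_num_measure//; exact: open_borel.
have meetS : meeting C (E n) `<=` meeting C (ball y rho).
  by move=> k [p [Cp Ep]]; exists p; split=> //; exact: Esub.
have [|y' [Ey' Wy' sy']] := tame_escape C_sub (E_open n) ae_tame ae_limsup.
  pose c' := K * 3 `^ s * rho `^ (s - t) * r n `^ (- tau) * fine (mu (E n)).
  have muE0 : 0 < fine (mu (E n)) by rewrite fine_gt0// muE_gt0//= ltey_eq muEfin.
  have c'0 : 0 <= c' by rewrite /c' !mulr_ge0 ?powR_ge0 ?fine_ge0.
  apply: (@le_lt_trans _ _ (c'%:E *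
      \sum_(k <oo | k \in meeting C (ball y rho)) (rad k `^ t)%:E)%E).
    apply: nneseries_le_scale => // [k _|k kE]; first by rewrite lee_fin powR_ge0.
    have radk : 0 < rad k by case: kE => p [Cp _]; apply: rad_gt0; exists p.
    apply: (le_trans (muE_ball _ r1 _)); first by rewrite mulr_gt0.
    rewrite -[X in (_ * X <= _)%E](fineK muEfin) -!EFinM lee_fin /c'.
    rewrite powRM ?(ltW radk)//.
    have -> : rad k `^ s = rad k `^ (s - t) * rad k `^ t.
      by rewrite -gt0_powRD// subrK.
    have : rad k `^ (s - t) <= rho `^ (s - t).
      rewrite ge0_ler_powR ?nnegrE ?(ltW rho0) ?(ltW radk)//; first by lra.
      exact/ltW/rad_lt/meetS.
    move=> le_rad.
    have -> : K * (3 `^ s * (rad k `^ (s - t) * rad k `^ t)) * r n `^ (- tau) *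
        fine (mu (E n)) = (K * 3 `^ s * r n `^ (- tau) * fine (mu (E n)) *
        rad k `^ t) * rad k `^ (s - t) by ring.
    have -> : K * 3 `^ s * rho `^ (s - t) * r n `^ (- tau) * fine (mu (E n)) *
        rad k `^ t = (K * 3 `^ s * r n `^ (- tau) * fine (mu (E n)) *
        rad k `^ t) * rho `^ (s - t) by ring.
    by rewrite ler_wpM2l// !mulr_ge0 ?powR_ge0// ltW.
  apply: (@le_lt_trans _ _ (c'%:E * (M * rho `^ beta)%:E)%E).
    by apply: lee_wpmul2l; rewrite ?lee_fin.
  rewrite -EFinM -(fineK muEfin) lte_fin.
  have -> : c' * (M * rho `^ beta) = (c * r n `^ ((s - t) / 2)) * fine (mu (E n)).
    rewrite /c' /c /rho !powRM ?(ltW rn)//.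
    have -> : r n `^ ((s - t) / 2) = r n `^ (s - t) * r n `^ (- tau) * r n `^ beta.
      by rewrite -!gt0_powRD//; congr (_ `^ _); field.
    by rewrite (gt0_powRD (s - t))//; ring.
  by rewrite gtr_pMl// hP// rn rh.
exists n, y'; split=> //.
apply: (subset_trans Esub); apply: le_ball; rewrite /rho; lra.
Qed.

(** The balls of radius [2 rho_j] around the successive sparse points [y_j] lie
    in sets [E_n] of larger and larger index, and the [C_k] that meet the
    [j]-th one have radius below [1 / j]. *)
Lemma sparse_limsup (y : Y) (O : set Y) :
  lim_sup_set W y -> sparse y -> open O -> O y ->
  exists2 p, O p & lim_sup_set E p /\ forall k, ~ C k p.
Proof.
move=> Wy sy oO Oy.
pose ok (p : Y * R) := [/\ lim_sup_set W p.1, sparse p.1 & 0 < p.2].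
(* the factor 2 leaves room for the limit of the centres, which is only known
   to lie in the closed balls of radius [p.2] *)
pose next (m : nat) (p p' : Y * R) (n : nat) := [/\ ok p', (m <= n)%N,
  E n `<=` ball p.1 p.2, ball p'.1 (2 * p'.2) `<=` E n &
  forall k, meeting C (ball p'.1 (2 * p'.2)) k -> rad k < m.+1%:R^-1].
have nextP (pm : (Y * R) * nat) : exists p'n : (Y * R) * nat,
    ok pm.1 -> next pm.2 pm.1 p'n.1 p'n.2.
  case: pm => -[y1 e1] m.
  have [[/= Wy1 sy1 e10]|nok] := pselect (ok (y1, e1)); last first.
    by exists ((y1, e1), m).
  have [n [y2 [mn En1 En2 Wy2 sy2]]] := sparse_step m Wy1 sy1 e10.
  have [M [r0 [_ r00 sr0]]] := sy2.
  have /nbhs_ballP[e/= e0 eE] : nbhs y2 (E n) by exact: open_nbhs_nbhs.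
  pose e2 := Num.min e (Num.min (r0 / 2) m.+1%:R^-1).
  have e2_gt0 : 0 < e2 by rewrite !lt_min e0 divr_gt0//= invr_gt0 ltr0n.
  have e2r0 : e2 < r0.
    rewrite (@le_lt_trans _ _ (r0 / 2))//; last first.
      by rewrite ltr_pdivrMr// ltr_pMr// ltr1n.
    by rewrite /e2 !ge_min lexx !orbT.
  exists ((y2, e2 / 2), n) => _; rewrite /next /ok/=.
  rewrite (mulrC 2) divfK ?pnatr_eq0//.
  split => //.
  - by split => //; rewrite divr_gt0.
  - by apply: subset_trans eE; apply: le_ball; rewrite /e2 ge_min lexx.
  - move=> k mk; have [|+ _] := sr0 e2; first by rewrite e2_gt0.
    by move=> /(_ _ mk) /lt_le_trans; apply; rewrite /e2 !ge_min lexx !orbT.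
have [f fP] := choice nextP.
have /nbhs_ballP[e/= e0 eO] : nbhs y O by exact: open_nbhs_nbhs.
pose u := fix u j := if j is i.+1 then (f (u i, i)).1 else (y, e / 2).
have uok j : ok (u j).
  elim: j => [|j IH]; first by split=> //=; rewrite divr_gt0.
  by have [] := fP (u j, j) IH.
pose N j := (f (u j, j)).2.
have uP j : next j (u j) (u j.+1) (N j) by exact: (fP (u j, j) (uok j)).
have ball_dec i j : ball (u (i + j.+1)%N).1 (u (i + j.+1)%N).2 `<=` ball (u i).1 (u i).2.
  have step l : ball (u l.+1).1 (u l.+1).2 `<=` ball (u l).1 (u l).2.
    have [[_ _ ul] _ Nl1 Nl2 _] := uP l.
    apply: subset_trans Nl1; apply: subset_trans Nl2; apply: le_ball.
    by rewrite ler_peMl ?ler1n// ltW.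
  elim: j => [|j IH]; first by rewrite addn1; exact: step.
  by rewrite addnS; exact: subset_trans (step _) IH.
have u_in i j : (i <= j)%N -> ball (u i).1 (u i).2 (u j).1.
  have [_ _ uj] := uok j.
  rewrite leq_eqVlt => /predU1P[->|ij]; first exact: ballxx.
  have -> : j = (i + (j - i.+1).+1)%N by rewrite addnS -addSn subnKC.
  by apply: ball_dec; apply: ballxx; have [] := uok (i + (j - i.+1).+1)%N.
have [p [_ clp]] : [set: Y] `&` cluster (fmap (fun j => (u j).1) \oo) !=set0.
  by apply: cptY; exact: filterT.
have p_in i : ball (u i).1 (2 * (u i).2) p.
  have [_ _ ui] := uok i.
  have [||q [[j /= ij <-]]] := clp [set (u j).1 | j in [set j | (i <= j)%N]]
      (ball p (u i).2).
  - by exists i => // j /= ij; exists j.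
  - exact: nbhsx_ballx.
  have := u_in _ _ ij; rewrite !ballEmdist/= (metric_sym p).
  by have := metric_triangle (u i).1 (u j).1 p; lra.
exists p; first by apply: eO; have := p_in 0%N; rewrite /= (mulrC 2) divfK ?pnatr_eq0.
split=> [m _|k Ckp].
  have [_ mN _ sub _] := uP m.
  by exists (N m) => //; apply: sub; exact: p_in.
have rk : 0 < rad k by apply: rad_gt0; exists p.
have [m] := ltr_add_invr rk.
rewrite add0r => mk.
have [_ _ _ _ /(_ k)] := uP m.
have mkp : meeting C (ball (u m.+1).1 (2 * (u m.+1).2)) k by exists p; split.
by move=> /(_ mkp); rewrite ltNge (ltW mk).
Qed.

End nested.

(** * Mass transference from balls to open sets *)

Section transference.
Variables (R : realType) (Y : pmetricType R) (mu : probability (borel Y) R).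
Variables (tau s K k0 : R).
Hypotheses (s_le : s <= tau) (K_ge0 : 0 <= K) (k0_gt0 : 0 < k0).
Hypothesis cptY : compact [set: Y].
Hypothesis mu_ball_le : forall (z : Y) (rho : R), 0 < rho ->
  (mu (ball z rho) <= (K * rho `^ tau)%:E)%E.
Hypothesis mu_ball_ge : forall (z : Y) (rho : R), 0 < rho <= 1 ->
  ((k0 * rho `^ tau)%:E <= mu (ball z rho))%E.
Variables (b : R) (N : int -> set nat) (Q : int -> nat -> set Y).
Hypotheses (b_gt0 : 0 < b) (b_lt : b < 3^-1).
Hypothesis cubes : generalized_dyadic_cubes b N Q.
Variables (x : nat -> Y) (r : nat -> R) (E : nat -> set Y).
Hypothesis r_gt0 : forall n, 0 < r n.
Hypothesis r_cvg : r n @[n --> \oo] --> 0.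
Hypothesis E_open : forall n, open (E n).
Hypothesis E_sub : forall n, r n < 1 -> E n `<=` ball (x n) (r n).
Hypothesis muE_gt0 : forall n, r n < 1 -> (0 < mu (E n))%E.
Hypothesis muE_ball : forall n (z : Y) (rho : R), r n < 1 -> 0 < rho ->
  (mu (E n `&` ball z rho) <= (K * rho `^ s * r n `^ (- tau))%:E * mu (E n))%E.
Local Notation W := (fun n => ball (x n) (r n)).
Hypothesis mu_limsup : mu (lim_sup_set W) = 1%E.

Let ae_limsup : {ae mu, forall y, lim_sup_set W y}.
Proof.
have mW : measurable (lim_sup_set W : set (borel Y)).
  apply: bigcap_measurable => // n _; apply: bigcup_measurable => k _.
  exact: ball_borel.
exists (~` lim_sup_set W : set (borel Y)); split=> //; first exact: measurableC.
by rewrite probability_setC// mu_limsup subee.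
Qed.

Local Notation c1 := (2^-1 - b / (1 - b)).
Local Notation c1' := ((1 - b)^-1).

Let c1_gt0 : 0 < c1.
Proof.
rewrite subr_gt0 ltr_pdivrMr; last by have := b_lt; lra.
by have := b_lt; lra.
Qed.

Let c1_lt1 : c1 < 1.
Proof.
have : 0 < b / (1 - b) by rewrite divr_gt0//; have := b_lt; lra.
by lra.
Qed.

Let c1'_gt0 : 0 < c1'.
Proof. by rewrite invr_gt0; have := b_lt; lra. Qed.

Let b_lt1 : b < 1.
Proof. by have := b_lt; lra. Qed.

Let bexp_gt0 (n : int) : 0 < b ^ n.
Proof. exact: exprz_gt0. Qed.

Let bexp_le (m n : int) : 0 <= m -> m <= n -> b ^ n <= b ^ m.
Proof.
move=> m0 mn; apply: ler_wpiXz2l => //; [exact: ltW|exact: ltW|].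
exact: le_trans mn.
Qed.

Let bexp_le1 (n : int) : 1 <= n -> b ^ n <= 1.
Proof. by move=> n1; rewrite -[leRHS](expr0z b) bexp_le// (le_trans _ n1). Qed.

Section cover.
Variables (t : R) (A : set Y) (I : set nat) (F : nat -> set Y).
Hypothesis t_gt0 : 0 < t.
Hypothesis t_lt : t < s.
Hypothesis QA : dyadic_family N Q A.
Hypothesis QF : forall k, I k -> dyadic_family N Q (F k).
Hypothesis small :
  (\sum_(k <oo | k \in I) mu (F k) `^ (t / tau) < mu A `^ (t / tau))%E.

Let tau_gt0 : 0 < tau.
Proof. by rewrite (lt_le_trans _ s_le)// (lt_trans t_gt0). Qed.

Let theta01 : 0 < t / tau <= 1.
Proof.
rewrite divr_gt0//= ler_pdivrMr// mul1r.
exact: le_trans (ltW t_lt) s_le.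
Qed.

Let inner_radius_le1 (n : int) : 1 <= n -> c1 * b ^ n <= 1.
Proof.
move=> n1; rewrite -[leRHS]mulr1 ler_pM ?bexp_le1//.
- exact: ltW.
- exact/ltW/bexp_gt0.
- exact: ltW.
Qed.

(** A cube has measure at least that of its inner ball, whose radius is a fixed
    multiple of the outer one. *)
Lemma cube_radius_le (B : set Y) (z : Y) (n : int) : 1 <= n ->
  measurable (B : set (borel Y)) -> ball z (c1 * b ^ n) `<=` B ->
  (((c1' * b ^ n) `^ t)%:E <=
    ((c1' / c1) `^ t / k0 `^ (t / tau))%:E * mu B `^ (t / tau))%E.
Proof.
move=> n1 mB ballB.
pose rho := c1 * b ^ n.
have rho0 : 0 < rho by rewrite mulr_gt0.
have muB : mu B = (fine (mu B))%:E by rewrite fineK// fin_num_measure.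
have : ((k0 * rho `^ tau)%:E <= mu B)%E.
  apply: (le_trans (mu_ball_ge z _)); first by rewrite rho0 inner_radius_le1.
  by apply: le_measure; rewrite ?inE//; exact: ball_borel.
rewrite muB poweR_EFin -EFinM !lee_fin; set f := fine _ => le_f.
have -> : (c1' * b ^ n) `^ t = (c1' / c1) `^ t * rho `^ t.
  rewrite -powRM ?(ltW rho0) ?divr_ge0 ?(ltW c1_gt0) ?(ltW c1'_gt0)//.
  by rewrite /rho mulrA divfK ?gt_eqF.
rewrite -mulrA ler_wpM2l ?powR_ge0// mulrC ler_pdivlMr ?powR_gt0//.
have -> : rho `^ t * k0 `^ (t / tau) = (k0 * rho `^ tau) `^ (t / tau).
  rewrite powRM ?powR_ge0 ?(ltW k0_gt0)// -powRrM mulrC.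
  by rewrite mulrCA divff ?mulr1 ?gt_eqF.
have kr0 : 0 <= k0 * rho `^ tau by rewrite mulr_ge0 ?powR_ge0 ?ltW.
case/andP: theta01 => /ltW th0 _.
by rewrite ge0_ler_powR ?nnegrE// (le_trans kr0).
Qed.

(** The starting point of the descent is found near a tame point [y] of [A]
    that no [F_k] contains, in the inner ball of a small cube around [y]. *)
Lemma limsup_not_covered :
  exists2 p, A p & lim_sup_set E p /\ forall k, I k -> ~ F k p.
Proof.
have [zz [mQ QT Qnest Qball _]] := cubes.
have mfam B : dyadic_family N Q B -> measurable (B : set (borel Y)).
  by case=> [->|[n [i [_ Ni ->]]]] //; exact: mQ.
have mF k : I k -> measurable (F k : set (borel Y)) by move=> /QF/mfam.
have [F_lt UF_lt] := measure_bigcup_lt theta01 mF (mfam _ QA) small.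
(* a set of the cover smaller than A cannot be the whole space *)
have Fcube k : I k -> exists ni : int * nat,
    [/\ (1 <= ni.1)%R, N ni.1 ni.2 & F k = Q ni.1 ni.2].
  move=> Ik; case: (QF Ik) => [FT|[n [i ?]]]; last by exists (n, i).
  have := F_lt _ Ik; rewrite FT probability_setT ltNge.
  by rewrite probability_le1//; exact: mfam.
have /choice[ni niP] : forall k, exists ni : int * nat, I k ->
    [/\ (1 <= ni.1)%R, N ni.1 ni.2 & F k = Q ni.1 ni.2].
  move=> k; have [/Fcube[p ?]|nIk] := pselect (I k); first by exists p.
  by exists (0, 0%N).
(* the family is extended to all indices by empty sets of radius 0 *)
pose C k := if k \in I then F k else set0.
pose z k := zz (ni k).1 (ni k).2.
pose rad k := if k \in I then c1' * b ^ (ni k).1 else 0.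
have C_sub k : C k `<=` metric_closed_ball (z k) (rad k).
  rewrite /C /rad /z; case: ifPn => [/set_mem Ik|_]; last exact: sub0set.
  have [n1 Nk ->] := niP _ Ik.
  by have [] := Qball _ _ Nk.
have rad_gt0 k : C k !=set0 -> 0 < rad k.
  by rewrite /C /rad; case: ifPn => [_ _|_ [p []]]; rewrite mulr_gt0.
have sum_rad : (\sum_(k <oo) (rad k `^ t)%:E < +oo)%E.
  pose c := (c1' / c1) `^ t / k0 `^ (t / tau).
  have c0 : 0 <= c by rewrite divr_ge0 ?powR_ge0.
  have -> : (\sum_(k <oo) (rad k `^ t)%:E =
      \sum_(k <oo | k \in I) (rad k `^ t)%:E)%E.
    rewrite [RHS]eseries_mkcond; apply: eq_eseriesr => k _.
    by rewrite /rad; case: ifPn => // _; rewrite powR0// gt_eqF.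
  apply: (@le_lt_trans _ _
      (c%:E * \sum_(k <oo | k \in I) mu (F k) `^ (t / tau))%E).
    apply: nneseries_le_scale => // [k _|k _|k Ik].
    - by rewrite lee_fin powR_ge0.
    - exact: poweR_ge0.
    have [n1 Nk Fk] := niP _ Ik; have [ballF _] := Qball _ _ Nk.
    rewrite /rad mem_set// Fk.
    by apply: (cube_radius_le (z := zz (ni k).1 (ni k).2)) => //; exact: mQ.
  apply: lte_mul_pinfty; rewrite ?lee_fin//.
  apply: lt_trans small _; apply: poweR_lty.
  by rewrite ltey_eq fin_num_measure//; exact: mfam.
pose e := (s - t) / 2.
have e_gt0 : 0 < e by rewrite divr_gt0 ?subr_gt0.
have beta_ge0 : 0 <= tau - e.
  by rewrite /e; have := t_lt; have := s_le; have := t_gt0; lra.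
have beta_lt : tau - e < tau by lra.
have ae_tame : {ae mu, forall y, tame t (tau - e) z rad y}.
  apply: (ae_local_weight beta_ge0 beta_lt K_ge0 mu_ball_le) => // k.
  exact: powR_ge0.
have mUF : measurable (\bigcup_(k in I) F k : set (borel Y)).
  exact: bigcup_measurable.
have mA := mfam _ QA.
have pos : (0 < mu (A `\` \bigcup_(k in I) F k))%E.
  rewrite measureD//; last by rewrite ltey_eq fin_num_measure.
  rewrite sube_gt0; apply: le_lt_trans UF_lt; apply: le_measure; rewrite ?inE//.
  exact: measurableI.
have mAUF : measurable (A `\` \bigcup_(k in I) F k : set (borel Y)).
  exact: measurableD.
have [y [Ay nFy] [[M M0 tM] _]] := ae_setI_nonempty mAUF pos ae_tame ae_limsup.
have [m0 m0A] : exists m0 : nat, forall (m : nat) i, (m0 <= m)%N -> N m i ->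
    Q m i y -> Q m i `<=` A.
  case: QA Ay => [-> _|[n [i [n1 Ni ->]]] Qy]; first by exists 0%N.
  exists `|n|%N => m j nm Nj Qjy.
  have nm' : n <= m by rewrite -(gez0_abs (le_trans _ n1)).
  have [QQ0|//] := Qnest _ _ _ _ nm' Nj Ni.
  by have : (Q m j `&` Q n i) y by []; rewrite QQ0.
have g0 : 0 < tau - t - e by rewrite /e; have := t_lt; have := s_le; lra.
pose c := K * 3 `^ tau * M * 4 `^ (tau - e).
have k1 : 0 < k0 * (c1 / c1') `^ tau by rewrite mulr_gt0// powR_gt0 ?divr_gt0.
have [h h0 hP] := powR_small c g0 k1.
(* the scale at which the cover has become negligible near y *)
have [m [m1 m0m rho_small]] : exists m : nat,
    [/\ (1 <= m)%N, (m0 <= m)%N & c1' * b ^ m < Num.min h 4^-1].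
  have hm : 0 < Num.min h 4^-1 by rewrite lt_min h0 invr_gt0 ltr0n.
  have b1 : `|b| < 1 by rewrite gtr0_norm.
  have /cvgrPdist_lt/(_ _ hm)[n _ nP] := cvg_geometric c1' b1.
  exists (maxn 1 (maxn m0 n)).
  rewrite !leq_max leqnn/= leqnn orbT; split=> //.
  have := nP (maxn 1 (maxn m0 n)); rewrite /= !leq_max leqnn !orbT => /(_ isT).
  by rewrite sub0r normrN gtr0_norm ?mulr_gt0 ?exprn_gt0.
move: rho_small; set rho := c1' * b ^ m; rewrite lt_min => /andP[rhoh rho4].
have rho_gt0 : 0 < rho by rewrite mulr_gt0.
have m1' : (1 <= m%:Z)%R by [].
have [i Ni Qy] : (\bigcup_(i in N m) Q m i) y by rewrite (QT m).1.
have [ballQ Qball'] := Qball _ _ Ni.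
pose O := ball (zz m i) (c1 * b ^ m).
have OA : O `<=` A by apply: (subset_trans ballQ); exact: m0A.
have meetO k : meeting C O k ->
    [/\ I k, rad k <= rho & mdist (z k) y < 4 * rho].
  move=> [p [Ckp Op]]; have := C_sub _ _ Ckp.
  move: Ckp; rewrite /C /rad; case: ifPn => // /set_mem Ik Fkp.
  have [n1 Nk Fk] := niP _ Ik; move=> zp.
  (* an earlier cube that meets the new one contains it, hence contains y *)
  have mk : m%:Z <= (ni k).1.
    rewrite leNgt; apply/negP => /ltW km.
    have [QQ0|QF'] := Qnest _ _ _ _ km Ni Nk.
      have : (Q m i `&` Q (ni k).1 (ni k).2) p.
        by split; [exact: ballQ|rewrite -Fk].
      by rewrite QQ0.
    by apply: nFy; exists k => //; rewrite Fk; exact: QF'.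
  have radrho : c1' * b ^ (ni k).1 <= rho.
    by rewrite /rho ler_wpM2l ?(ltW c1'_gt0)// bexp_le.
  split=> //; move: zp; rewrite /metric_closed_ball/=.
  have := Qball' _ (ballQ _ Op); have := Qball' _ Qy.
  rewrite /metric_closed_ball/= -/rho.
  have := metric_triangle (z k) p y; have := metric_triangle p (zz m i) y.
  by rewrite (metric_sym p (zz m i)); move: radrho rho_gt0; lra.
have [|p [Op Wp sp]] := tame_escape C_sub (open_mball _ _ : open O) ae_tame ae_limsup.
  pose c' := K * 3 `^ tau * rho `^ (tau - t).
  have c'0 : 0 <= c' by rewrite /c' !mulr_ge0 ?powR_ge0.
  apply: (@le_lt_trans _ _ (c'%:E *
      \sum_(k <oo | k \in [set k | (mdist (z k) y < 4 * rho)%R]) (rad k `^ t)%:E)%E).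
    apply: nneseries_le_scale => // [k /meetO[]//|k _|k kO].
      by rewrite lee_fin powR_ge0.
    have radk : 0 < rad k by apply: rad_gt0; case: kO => q [Cq _]; exists q.
    have [Ik rad_le _] := meetO _ kO.
    have r3 : 0 < 3 * rad k by rewrite mulr_gt0.
    apply: (le_trans _ (le_trans (mu_ball_le (z k) r3) _)).
      apply: le_measure; rewrite ?inE; [|exact: ball_borel|exact: subIsetr].
      by apply: measurableI; exact: ball_borel.
    rewrite -EFinM lee_fin /c' powRM ?(ltW radk)//.
    have -> : rad k `^ tau = rad k `^ (tau - t) * rad k `^ t.
      by rewrite -gt0_powRD// subrK.
    rewrite !mulrA ler_wpM2r ?powR_ge0// ler_wpM2l ?mulr_ge0 ?powR_ge0//.
    rewrite ge0_ler_powR ?nnegrE ?(ltW rho_gt0) ?(ltW radk)// subr_ge0.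
    exact: le_trans (ltW t_lt) s_le.
  apply: (@le_lt_trans _ _ (c'%:E * (M * (4 * rho) `^ (tau - e))%:E)%E).
    apply: lee_wpmul2l; rewrite ?lee_fin//; apply: tM.
    by rewrite mulr_gt0//=; move: rho4; lra.
  have c1b : c1 * b ^ m = c1 / c1' * rho by rewrite /rho mulrA divfK ?gt_eqF.
  have : ((k0 * (c1 / c1' * rho) `^ tau)%:E <= mu O)%E.
    rewrite /O c1b; apply: mu_ball_ge; rewrite -c1b mulr_gt0//=.
    exact: inner_radius_le1.
  apply: lt_le_trans; rewrite -EFinM lte_fin.
  have -> : c' * (M * (4 * rho) `^ (tau - e)) = c * rho `^ (tau - t - e) * rho `^ tau.
    rewrite /c' /c (@powRM _ 4) ?(ltW rho_gt0)//.
    rewrite -[RHS]mulrA.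
    have -> : rho `^ (tau - t - e) * rho `^ tau = rho `^ (tau - t) * rho `^ (tau - e).
      by rewrite -!gt0_powRD//; congr (_ `^ _); ring.
    ring.
  rewrite (@powRM _ (c1 / c1')) ?(ltW rho_gt0) ?divr_ge0 ?(ltW c1_gt0) ?(ltW c1'_gt0)//.
  by rewrite mulrA ltr_pM2r ?powR_gt0// hP// rho_gt0.
have [q Oq [Eq Cq]] := sparse_limsup t_lt K_ge0 cptY r_gt0 r_cvg E_open E_sub
  muE_gt0 muE_ball ae_limsup C_sub rad_gt0 ae_tame Wp sp (open_mball _ _) Op.
exists q; first exact: OA.
by split=> // k Ik Fkq; apply: (Cq k); rewrite /C mem_set.
Qed.

End cover.

(** A family of cubes that covers [limsup E_n] in [A] has total weight at least
    that of [A], so covering [A] by itself is optimal both for [A] and for its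
    part in [limsup E_n]. *)
Theorem limsup_large_intersection :
  large_intersection_class mu tau (dyadic_family N Q) s (lim_sup_set E).
Proof.
split.
  exists (fun n => \bigcup_(j in [set j | (n <= j)%N]) E j) => // n.
  by apply: bigcup_open => j _; exact: E_open.
move=> t A /andP[t0 ts] QA; apply/eqP; rewrite eq_le; apply/andP; split.
  apply: le_ereal_inf_tmp => v [I [F [QF AF ->]]].
  apply: ereal_inf_lbound; exists I, F; split=> //.
  by apply: subset_trans AF; exact: subIsetr.
apply: (@le_trans _ _ (mu A `^ (t / tau))%E).
  apply: ereal_inf_lbound; exists [set 0%N], (fun=> A); split=> //.
    by rewrite bigcup_set1.
  by rewrite esum_set1// poweR_ge0.
apply: le_ereal_inf_tmp => v [I [F [QF AF ->]]].
rewrite leNgt; apply/negP; rewrite esum_nneseries => [small|k _]; last first.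
  exact: poweR_ge0.
have [p Ap [Ep nFp]] := limsup_not_covered t0 ts QA QF small.
by have [k Ik Fkp] := AF _ (conj Ep Ap); exact: (nFp k).
Qed.

End transference.

(** * Topology of the product *)

Section max_prod_topology.
Variables (R : realType) (d : nat) (X : 'I_d -> pmetricType R).
Local Notation XX := (max_prod X).

Lemma ball_max_prod (x : XX) (r : R) : 0 < r ->
  ball x r = prod_set (fun i => ball (x i : X i) r).
Proof.
move=> r0; apply/seteqP; split=> y; rewrite ballEmdist/=.
  move=> xyr i; rewrite ballEmdist/=; apply: le_lt_trans xyr.
  exact: (le_bigmax _ (fun i => mdist (x i : X i) (y i)) i).
move=> xy; apply: bigmax_lt => // i _.
by have := xy i; rewrite ballEmdist.
Qed.

Lemma open_prod_set (A : forall i, set (X i)) :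
  (forall i, open (A i)) -> open (prod_set A).
Proof.
move=> oA; rewrite openE => x Ax; rewrite /interior.
have /choice[e eP] : forall i, exists e : R, 0 < e /\ ball (x i : X i) e `<=` A i.
  move=> i; have /nbhs_ballP[e/= e0 eA] : nbhs (x i : X i) (A i).
    exact: open_nbhs_nbhs.
  by exists e.
apply/nbhs_ballP; exists (\big[Num.min/1]_i e i) => /=.
  by apply: lt_bigmin => // i _; have [] := eP i.
move=> y; rewrite ball_max_prod; last first.
  by apply: lt_bigmin => // i _; have [] := eP i.
move=> xy i; have [_] := eP i; apply; apply: le_ball (xy i).
exact: bigmin_le.
Qed.

(** An ultrafilter on the product converges to the point formed by cluster
    points of its projections: for an ultrafilter, clustering at a ball already
    means containing it. *)
Lemma compact_max_prod :
  (forall i, compact [set: X i]) -> compact [set: XX].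
Proof.
move=> cptX; rewrite compact_ultra => F FU _.
have clust : forall i, exists p : X i,
    forall e : R, 0 < e -> F [set x | ball p e (x i)].
  move=> i.
  have [p [_ clp]] : [set: X i] `&` cluster (fmap (fun x : XX => x i) F) !=set0.
    by apply: cptX; exact: filterT.
  exists p => e e0; have [//|nF] := in_ultra_setVsetC [set x | ball p e (x i)] FU.
  have [|q [nq pq]] := clp (~` ball p e) (ball p e) nF _; first exact: nbhsx_ballx.
  by exfalso.
pose p : XX := fun i => projT1 (cid (clust i)).
have pP i := projT2 (cid (clust i)).
exists p; split=> // B /nbhs_ballP[e/= e0 eB].
apply: filterS eB _; rewrite ball_max_prod//.
have FP : Filter F by exact: ultra_proper.
exact: (@filter_forall _ _ (fun i => [set x : XX | ball (p i) e (x i)]) F FP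
  (fun i => pP i e e0)).
Qed.

End max_prod_topology.

(** * Measure of rectangles *)

Lemma prod_powR (R : realType) (I : finType) (J : pred I) (r : R) (f : I -> R) :
  0 < r -> \prod_(i | J i) r `^ f i = r `^ (\sum_(i | J i) f i).
Proof.
move=> r0; apply: (big_rec2 (fun u v => u = r `^ v)) => [|i u v _ ->].
  by rewrite powRr0.
by rewrite gt0_powRD.
Qed.

(** Regularity only speaks of radii up to the diameter.  With [D] at most 1 and
    at most the diameter, scaling radii by [D] extends the lower bound to
    [r <= 1], and [mu <= 1 <= (r / D)^sigma] gives the upper bound for
    [r > D]. *)
Lemma ahlfors_regular_bounds (R : realType) (Y : pmetricType R)
    (nu : probability (borel Y) R) (sigma : R) :
  0 < sigma -> (exists y z : Y, y <> z) -> ahlfors_regular nu sigma ->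
  exists K : R, [/\ 1 <= K,
    forall (z : Y) r, 0 < r -> (nu (ball z r) <= (K * r `^ sigma)%:E)%E &
    forall (z : Y) r, 0 < r <= 1 ->
      ((K^-1 * r `^ sigma)%:E <= nu (ball z r))%E].
Proof.
move=> sigma0 [y [z yz]] [C C1 CP].
pose D := Num.min 1 (mdist y z).
have D0 : 0 < D by rewrite lt_min ltr01/= mdist_gt0; apply/eqP.
have D1 : D <= 1 by rewrite /D ge_min lexx.
have Ddiam : (D%:E <= diam Y)%E.
  apply: (@le_trans _ _ (mdist y z)%:E); first by rewrite lee_fin /D ge_min lexx orbT.
  by apply: ereal_sup_ubound; exists (y, z).
have C0 : 0 < C by rewrite (lt_le_trans _ C1).
have DK : 1 <= (D `^ sigma)^-1.
  rewrite invf_ge1 ?powR_gt0// (_ : 1 = 1 `^ sigma); last by rewrite powR1.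
  by rewrite ge0_ler_powR ?nnegrE// ltW.
have K1 : 1 <= C * (D `^ sigma)^-1 by rewrite -[leLHS]mulr1 ler_pM.
exists (C * (D `^ sigma)^-1); split=> // [u r r0|u r /andP[r0 r1]].
  have [rD|Dr] := leP r D.
    have rdiam : (r%:E <= diam Y)%E by apply: le_trans Ddiam; rewrite lee_fin.
    have /andP[_ h] := CP u r r0 rdiam; apply: (le_trans h).
    by rewrite lee_fin ler_wpM2r ?powR_ge0// ler_peMr// ltW.
  apply: (le_trans (probability_le1 _ _)); first exact: ball_borel.
  rewrite lee_fin -mulrA -[leLHS]mulr1 ler_pM// mulrC ler_pdivlMr ?powR_gt0//.
  by rewrite mul1r ge0_ler_powR ?nnegrE ?ltW.
have Dr0 : 0 < D * r by rewrite mulr_gt0.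
have DrD : D * r <= D by rewrite ler_piMr// ltW.
apply: (@le_trans _ _ (nu (ball u (D * r)))); last first.
  apply: le_measure; rewrite ?inE; [exact: ball_borel|exact: ball_borel|].
  by apply: le_ball; rewrite ler_piMl// ltW.
have rdiam : ((D * r)%:E <= diam Y)%E by apply: le_trans Ddiam; rewrite lee_fin.
have /andP[+ _] := CP u _ Dr0 rdiam.
apply: le_trans; rewrite lee_fin powRM ?(ltW D0) ?(ltW r0)//.
by rewrite invfM invrK mulrA.
Qed.

Section exponent.
Variables (R : realType) (d : nat) (s a : 'I_d -> R).
Hypothesis s_gt0 : forall i, 0 < s i.
Hypothesis a_ge1 : forall i, 1 <= a i.
Hypothesis a_mono : forall i j : 'I_d, (i <= j)%N -> a i <= a j.
Local Notation tau := (\sum_(i < d) s i).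

Let a_gt0 i : 0 < a i.
Proof. exact: lt_le_trans (a_ge1 i). Qed.

(** The numerator is [tau + sum_(j <= i) (a_i - a_j) s_j], and the [a_j] are
    nondecreasing. *)
Lemma mtp_exponent_gt0 (i : 'I_d) : 0 < mtp_exponent s a i.
Proof.
rewrite /mtp_exponent divr_gt0// -addrA ltr_pwDl//.
  by rewrite (bigD1 i)//= ltr_pwDl// sumr_ge0// => j _; exact: ltW.
rewrite subr_ge0 mulr_sumr ler_sum// => j ji.
by rewrite ler_wpM2r ?a_mono// ltW.
Qed.

Lemma mtp_exponent0_le (d_gt0 : (0 < d)%N) :
  mtp_exponent s a (Ordinal d_gt0) <= tau.
Proof.
have first_term (f : 'I_d -> R) :
    \sum_(j < d | (j <= Ordinal d_gt0)%N) f j = f (Ordinal d_gt0).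
  rewrite (eq_bigl (pred1 (Ordinal d_gt0))) ?big_pred1_eq// => j.
  by rewrite /= -val_eqE/= leqn0.
rewrite /mtp_exponent ler_pdivrMr// !first_term addrK ler_peMr//.
by rewrite sumr_ge0// => j _; exact: ltW.
Qed.

(** Let [i] be the first index at which the partial sum of the [s_j] reaches
    [sigma].  Take [J = {j <= i}] if [rho <= r^(a_i)], and [J = {j < i}]
    otherwise.  In both cases [rho^(S_J - sigma) <= r^(a_i (S_J - sigma))],
    because [S_J - sigma] has the right sign, and the inequality becomes
    [a_i (S_J - sigma) - sum_J a_j s_j >= - tau], which says that [sigma] is at
    most the [i]-th exponent. *)
Lemma exists_rectangle_section (sigma r rho : R) :
  0 < sigma <= tau -> (forall i, sigma <= mtp_exponent s a i) ->
  0 < r < 1 -> 0 < rho ->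
  exists J : pred 'I_d,
    rho `^ (\sum_(i | J i) s i) * r `^ (- \sum_(i | J i) a i * s i)
      <= rho `^ sigma * r `^ (- tau).
Proof.
move=> /andP[sigma0 sigma_le] sigmaP /andP[r0 r1] rho0.
pose S k := \sum_(j < d | (j <= k)%N) s j.
have [i [Si Smin]] : exists i : 'I_d, sigma <= S i /\
    \sum_(j < d | (j < i)%N) s j < sigma.
  have exk : exists k, (k < d)%N && (sigma <= S k).
    case: d s @S sigma_le {sigmaP} s_gt0 => [|n] s' S sigma_le _.
      by move: sigma_le; rewrite big_ord0 leNgt sigma0.
    exists n; rewrite ltnSn/= (le_trans sigma_le)// /S.
    by rewrite [leRHS](eq_bigl xpredT)// => j; rewrite -ltnS ltn_ord.
  have [k /andP[kd Sk] kmin] := ex_minnP exk.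
  exists (Ordinal kd); split=> //=; case: k kd Sk kmin => [|k] kd Sk kmin.
    by rewrite big_pred0.
  rewrite ltNge; apply/negP => Sk'.
  have /kmin : (k < d)%N && (sigma <= S k) by rewrite (ltnW kd).
  by rewrite ltnn.
have rai : 0 < r `^ a i by rewrite powR_gt0.
(* [a_i S_J - sum_J a_j s_j] does not see whether [i] belongs to [J] *)
have balance (J : pred 'I_d) :
    a i * \sum_(j | J j) s j - \sum_(j | J j) a j * s j =
    a i * S i - \sum_(j < d | (j <= i)%N) a j * s j ->
    rho `^ (\sum_(j | J j) s j - sigma) <=
      (r `^ a i) `^ (\sum_(j | J j) s j - sigma) ->
  rho `^ (\sum_(j | J j) s j) * r `^ (- \sum_(j | J j) a j * s j)
      <= rho `^ sigma * r `^ (- tau).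
  set SJ := \sum_(j | J j) s j; set TJ := \sum_(j | J j) a j * s j.
  move=> eqJ le_rho.
  have -> : SJ = sigma + (SJ - sigma) by rewrite addrC subrK.
  rewrite gt0_powRD// -mulrA ler_wpM2l ?powR_ge0//.
  apply: (@le_trans _ _ ((r `^ a i) `^ (SJ - sigma) * r `^ (- TJ))).
    by rewrite ler_wpM2r ?powR_ge0.
  rewrite -powRrM -gt0_powRD//; apply: ger_powR; first by rewrite r0 ltW.
  have := sigmaP i; rewrite /mtp_exponent ler_pdivlMr// => h.
  rewrite mulrBr addrAC eqJ -/(S i).
  by move: h; rewrite -/(S i) mulrC; lra.
have [rho_le|rho_gt] := leP rho (r `^ a i).
  exists (fun j => (j <= i)%N); apply: balance => //.
  by rewrite ge0_ler_powR ?nnegrE ?subr_ge0 ?(ltW rho0) ?(ltW rai).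
exists (fun j => (j < i)%N); apply: balance.
  have DS (f : 'I_d -> R) : \sum_(j < d | (j <= i)%N) f j =
      f i + \sum_(j < d | (j < i)%N) f j.
    rewrite (bigD1 i)//=; congr (_ + _); apply: eq_bigl => j.
    by rewrite ltn_neqAle andbC.
  by rewrite /S !DS mulrDr; ring.
rewrite -opprB !powRN lef_pV2 ?posrE ?powR_gt0//.
by rewrite ge0_ler_powR ?nnegrE ?subr_ge0 ?(ltW Smin) ?(ltW rho0) ?(ltW rai) ?(ltW rho_gt).
Qed.

End exponent.

Section rectangle_measure.
Variables (R : realType) (d : nat) (X : 'I_d -> pmetricType R) (s : 'I_d -> R).
Variables (mu_ : forall i, probability (borel (X i)) R).
Variables (mu : probability (borel (max_prod X)) R) (K : 'I_d -> R).
Hypothesis mu_prod : forall A : (forall i, set (X i)),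
  (forall i, measurable (A i : set (borel (X i)))) ->
  mu (prod_set A) = (\prod_(i < d) mu_ i (A i))%E.
Hypothesis K_ge1 : forall i, 1 <= K i.
Hypothesis ball_le : forall i (z : X i) (rho : R), 0 < rho ->
  (mu_ i (ball z rho) <= (K i * rho `^ s i)%:E)%E.
Hypothesis ball_ge : forall i (z : X i) (rho : R), 0 < rho <= 1 ->
  (((K i)^-1 * rho `^ s i)%:E <= mu_ i (ball z rho))%E.

Local Notation tau := (\sum_(i < d) s i).
Local Notation KK := (\prod_(i < d) K i).
Let m i (A : set (X i)) := fine (mu_ i A).

Let K_gt0 i : 0 < K i.
Proof. exact: lt_le_trans (K_ge1 i). Qed.

Lemma prod_bound_ge1 : 1 <= KK.
Proof.
elim/big_rec: _ => // i u _ u1.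
by rewrite -[leLHS]mulr1 ler_pM.
Qed.

Let mE i (A : set (X i)) : open A -> mu_ i A = (m A)%:E.
Proof. by move=> oA; rewrite fineK// fin_num_measure//; exact: open_borel. Qed.

Let m_ge0 i (A : set (X i)) : 0 <= m A.
Proof. by rewrite fine_ge0. Qed.

Let m_le i (z : X i) rho : 0 < rho -> m (ball z rho) <= K i * rho `^ s i.
Proof.
by move=> rho0; rewrite -lee_fin -mE ?ball_le//; exact: open_mball.
Qed.

Let m_ge i (z : X i) rho : 0 < rho <= 1 ->
  (K i)^-1 * rho `^ s i <= m (ball z rho).
Proof.
by move=> rho01; rewrite -lee_fin -mE ?ball_ge//; exact: open_mball.
Qed.

Let mS i (A B : set (X i)) : open A -> open B -> m (A `&` B) <= m A.
Proof.
move=> oA oB; have oAB : open (A `&` B) by exact: openI.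
rewrite -lee_fin -!mE//.
apply: le_measure; rewrite ?inE; [exact: open_borel|exact: open_borel|].
exact: subIsetl.
Qed.

Let mu_prod_open (A : forall i, set (X i)) : (forall i, open (A i)) ->
  mu (prod_set A) = (\prod_(i < d) m (A i))%:E.
Proof.
move=> oA; rewrite mu_prod; last by move=> i; apply: open_borel; exact: oA.
by rewrite -prodEFin; apply: eq_bigr => i _; rewrite mE//; exact: oA.
Qed.

Lemma max_prod_ball_le (z : max_prod X) (rho : R) : 0 < rho ->
  (mu (ball z rho) <= (KK * rho `^ tau)%:E)%E.
Proof.
move=> rho0; rewrite ball_max_prod// mu_prod_open; last first.
  by move=> i; exact: open_mball.
rewrite lee_fin -prod_powR// -big_split/= ler_prod// => i _.
by rewrite m_ge0 m_le.
Qed.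

Lemma max_prod_ball_ge (z : max_prod X) (rho : R) : 0 < rho <= 1 ->
  ((KK^-1 * rho `^ tau)%:E <= mu (ball z rho))%E.
Proof.
move=> /andP[rho0 rho1]; rewrite ball_max_prod// mu_prod_open; last first.
  by move=> i; exact: open_mball.
rewrite lee_fin -prod_powR// -prodfV -big_split/= ler_prod// => i _.
rewrite mulr_ge0 ?powR_ge0 ?invr_ge0 ?(ltW (K_gt0 i))//=.
by apply: m_ge; rewrite rho0.
Qed.

Variables (c : forall i, X i) (u : 'I_d -> R).
Hypothesis u01 : forall i, 0 < u i <= 1.
Local Notation rectangle := (prod_set (fun i => ball (c i) (u i))).

Lemma rectangle_gt0 : (0 < mu rectangle)%E.
Proof.
rewrite mu_prod_open; last by move=> i; exact: open_mball.
rewrite lte_fin prodr_gt0// => i _.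
apply: lt_le_trans (m_ge _ (u01 i)).
by have /andP[u0 _] := u01 i; rewrite mulr_gt0 ?invr_gt0 ?powR_gt0.
Qed.

(** In a coordinate of [J] the side [B(c_i, u_i)] is compared with the ball of
    radius [rho]; in the other coordinates the intersection is bounded by the
    side itself. *)
Lemma rectangle_ball_le (J : pred 'I_d) (z : max_prod X) (rho : R) :
  0 < rho ->
  (mu (rectangle `&` ball z rho) <=
    (KK * KK * \prod_(i | J i) (rho / u i) `^ s i)%:E * mu rectangle)%E.
Proof.
move=> rho0.
have -> : rectangle `&` ball z rho =
    prod_set (fun i => ball (c i) (u i) `&` ball (z i : X i) rho).
  rewrite ball_max_prod//; apply/seteqP; split=> [y [y1 y2] i //|y yP].
  by split=> i; have [] := yP i.
rewrite !mu_prod_open; last 2 first.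
- by move=> i; exact: open_mball.
- by move=> i; apply: openI; exact: open_mball.
rewrite -EFinM lee_fin.
rewrite (big_mkcond J)/= -!big_split/= ler_prod// => i _.
have /andP[u0 u1] := u01 i.
rewrite m_ge0/=; set w := m (ball (c i) _).
have w0 : 0 <= w by exact: m_ge0.
case: ifPn => [_|_]; last first.
  rewrite mulr1 (@le_trans _ _ w)//; first by apply: mS; exact: open_mball.
  by rewrite ler_peMl// -[leLHS]mulr1 ler_pM.
apply: (@le_trans _ _ (K i * rho `^ s i)).
  apply: le_trans (m_le (z i) rho0).
  by rewrite setIC; apply: mS; exact: open_mball.
rewrite powRM ?invr_ge0 ?(ltW rho0) ?(ltW u0)// powR_invr ?(ltW u0)//.
have -> : K i * K i * (rho `^ s i / u i `^ s i) * w =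
  (K i * rho `^ s i) * (K i / u i `^ s i * w) by ring.
rewrite ler_peMr ?mulr_ge0 ?powR_ge0 ?(ltW (K_gt0 i))//.
rewrite mulrAC ler_pdivlMr ?powR_gt0// mul1r.
by rewrite -ler_pdivrMl//; apply: m_ge; rewrite u0.
Qed.

End rectangle_measure.

Theorem theorem4p4 (R : realType) (d : nat) (d_gt0 : (0 < d)%N)
    (X : 'I_d -> pmetricType R) (s : 'I_d -> R)
    (mu_ : forall i, probability (borel (X i)) R)
    (mu : probability (borel (max_prod X)) R)
    (b : R) (N : int -> set nat) (Q : int -> nat -> set (max_prod X))
    (x : nat -> forall i, X i) (r : nat -> R) (a : 'I_d -> R) :
  (forall i, compact [set: X i]) ->
  (forall i, exists y z : X i, y <> z) ->
  (forall i, 0 < s i) ->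
  (forall i, ahlfors_regular (mu_ i) (s i)) ->
  (forall A : (forall i, set (X i)),
     (forall i, measurable (A i : set (borel (X i)))) ->
     mu (prod_set A) = (\prod_(i < d) mu_ i (A i))%E) ->
  0 < b -> b < 3^-1 ->
  generalized_dyadic_cubes b N Q ->
  (forall n, 0 < r n) -> r n @[n --> \oo] --> 0 ->
  (forall i, 1 <= a i) ->
  (forall i j : 'I_d, (i <= j)%N -> a i <= a j) ->
  mu (lim_sup_set (fun n => prod_set (fun i => ball (x n i) (r n)))) = 1%E ->
  large_intersection_class mu (\sum_(i < d) s i) (dyadic_family N Q)
    (min_mtp_exponent d_gt0 s a)
    (lim_sup_set (fun n => prod_set (fun i => ball (x n i) (r n `^ a i)))).
Proof.
move=> cptX two s_gt0 reg mu_prod b0 b1 cubes r0 rcvg a1 amono full.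
have /all_sig[K KP] : forall i, {Ki : R | [/\ 1 <= Ki,
    forall (z : X i) rho, 0 < rho ->
      (mu_ i (ball z rho) <= (Ki * rho `^ s i)%:E)%E &
    forall (z : X i) rho, 0 < rho <= 1 ->
      ((Ki^-1 * rho `^ s i)%:E <= mu_ i (ball z rho))%E]}.
  by move=> i; apply: cid; exact: ahlfors_regular_bounds.
have K1 i : 1 <= K i by have [] := KP i.
have ball_le i (z : X i) rho : 0 < rho ->
    (mu_ i (ball z rho) <= (K i * rho `^ s i)%:E)%E.
  by have [_ + _] := KP i; apply.
have ball_ge i (z : X i) rho : 0 < rho <= 1 ->
    (((K i)^-1 * rho `^ s i)%:E <= mu_ i (ball z rho))%E.
  by have [_ _] := KP i; apply.
pose KK := \prod_(i < d) K i.
have KK1 : 1 <= KK by exact: prod_bound_ge1.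
have KK0 : 0 < KK by rewrite (lt_le_trans _ KK1).
pose sigma := min_mtp_exponent d_gt0 s a.
have sigma_le i : sigma <= mtp_exponent s a i by exact: bigmin_le.
have sigma_gt0 : 0 < sigma.
  by apply: lt_bigmin => [|i _]; exact: mtp_exponent_gt0.
have sigma_tau : sigma <= \sum_(i < d) s i.
  exact: le_trans (sigma_le _) (mtp_exponent0_le s_gt0 a1 d_gt0).
have ra_le n i : r n < 1 -> r n `^ a i <= r n.
  by move=> rn1; rewrite ge1r_powR// r0 ltW.
have ra01 n : r n < 1 -> forall i, 0 < r n `^ a i <= 1.
  by move=> rn1 i; rewrite powR_gt0//= (le_trans (ra_le _ i rn1))// ltW.
apply: (@limsup_large_intersection R (max_prod X) mu _ _ (KK * KK) KK^-1 _ _ _ _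
  _ _ b N Q _ _ cubes x r) => //.
- by rewrite mulr_ge0// ltW.
- by rewrite invr_gt0.
- exact: compact_max_prod.
- move=> z rho rho0; apply: (le_trans (max_prod_ball_le mu_prod ball_le z rho0)).
  by rewrite lee_fin ler_wpM2r ?powR_ge0// ler_peMl// ltW.
- by move=> z rho rho01; exact: (max_prod_ball_ge mu_prod K1 ball_ge z rho01).
- by move=> n; apply: open_prod_set => i; exact: open_mball.
- move=> n rn1; rewrite ball_max_prod// => y Ey i.
  by apply: le_ball (Ey i); exact: ra_le.
- by move=> n rn1; exact: (rectangle_gt0 mu_prod K1 ball_ge (x n) (ra01 _ rn1)).
- move=> n z rho rn1 rho0.
  have [|||J JP] := exists_rectangle_section (sigma := sigma) (r := r n)
    (rho := rho) s_gt0 a1 _ sigma_le _ _; rewrite ?sigma_gt0 ?r0//.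
  apply: (le_trans
    (rectangle_ball_le mu_prod K1 ball_le ball_ge (x n) (ra01 _ rn1) J z rho0)).
  apply: lee_wpmul2r => //; rewrite lee_fin -[leRHS]mulrA.
  apply: ler_wpM2l; first by rewrite mulr_ge0// ltW.
  apply: le_trans JP; rewrite le_eqVlt; apply/orP; left; apply/eqP.
  rewrite -!prod_powR// -sumrN -prod_powR// -big_split/=.
  apply: eq_bigr => i _.
  by rewrite powRM ?invr_ge0 ?powR_ge0 ?(ltW rho0)// -powRN -powRrM mulNr.
- have -> : (fun n => ball (x n : max_prod X) (r n)) =
      (fun n => prod_set (fun i => ball (x n i) (r n))).
    by apply/funext => n; rewrite ball_max_prod.
  exact: full.
Qed.
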